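(* Let $M^*\in\mathbb{R}^{d_1\times d_2}$ have rank $r$ with smallest nonzero singular value $\sigma_r(M^* )$, and let $f:\mathbb{R}^{d_1\times d_2}\to\mathbb{R}_+$ satisfy the two-phase regularity conditions of the context with parameters $\tau_{\mathrm c}>\tau_{\mathrm s}>0$ and $\mu_{\mathrm c},\mu_{\mathrm s},L_{\mathrm c},L_{\mathrm s}>0$. Let $(M_l)$ be the iterates of the Riemannian sub-gradient algorithm RsGrad (see context). Suppose the initialization $M_0\in\mathbb{M}_r$ satisfies $\|M_0-M^*\|_{\mathrm F}\le c_0\,\sigma_r(M^* )\cdot\min\{\mu_{\mathrm s}^2L_{\mathrm s}^{-2},\mu_{\mathrm c}^2L_{\mathrm c}^{-2}\}$ for a small but absolute constant $c_0>0$, and the initial stepsize satisfies $\eta_0\in\big[0.2\|M_0-M^*\|_{\mathrm F}\,\mu_{\mathrm c}L_{\mathrm c}^{-2},\ 0.3\|M_0-M^*\|_{\mathrm F}\,\mu_{\mathrm c}L_{\mathrm c}^{-2}\big]$. At the $l$-th iteration: (1) when $\|M_l-M^*\|_{\mathrm F}\ge\tau_{\mathrm c}$ (phase one), take the stepsize $\eta_l=(1-c\mu_{\mathrm c}^2L_{\mathrm c}^{-2})^l\eta_0$ with any fixed constant $0<c\le 0.04$; then $$\|M_{l+1}-M^*\|_{\mathrm F}\le\Big(1-c\frac{\mu_{\mathrm c}^2}{L_{\mathrm c}^2}\Big)^{l+1}\|M_0-M^*\|_{\mathrm F};$$ (2) when $\tau_{\mathrm c}>\|M_l-M^*\|_{\mathrm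 F}\ge\tau_{\mathrm s}$ (phase two), take the stepsize $\eta_l=\eta\in\mu_{\mathrm s}L_{\mathrm s}^{-2}\cdot[0.125,0.75]$; then $$\|M_{l+1}-M^*\|_{\mathrm F}\le\Big(1-\frac{\mu_{\mathrm s}^2}{32L_{\mathrm s}^2}\Big)\|M_l-M^*\|_{\mathrm F}.$$
   Context: $\mathbb{M}_r=\{M\in\mathbb{R}^{d_1\times d_2}:\mathrm{rank}(M)\le r\}$; $\|\cdot\|_{\mathrm F}$ is the Frobenius norm; $\mathrm{SVD}_r(\cdot)$ is the best rank-$r$ approximation (truncated SVD); $\|G\|_{\mathrm F,r}:=\|\mathrm{SVD}_r(G)\|_{\mathrm F}$. A sub-gradient $G\in\partial f(M)$ is a matrix with $f(M')\ge f(M)+\langle G,M'-M\rangle$ for all $M'$. Two-phase regularity conditions: with $\mathbb{B}_1=\{M\in\mathbb{M}_r:\|M-M^*\|_{\mathrm F}\ge\tau_{\mathrm c}\}$ and $\mathbb{B}_2=\{M\in\mathbb{M}_r:\tau_{\mathrm c}>\|M-M^*\|_{\mathrm F}\ge\tau_{\mathrm s}\}$, (i) $f(M)-f(M^* )\ge\mu_{\mathrm c}\|M-M^*\|_{\mathrm F}$ for $M\in\mathbb{B}_1$ and $f(M)-f(M^* )\ge\mu_{\mathrm s}\|M-M^*\|_{\mathrm F}^2$ for $M\in\mathbb{B}_2$; (ii) for every $G\in\partial f(M)$: $\|G\|_{\mathrm F,r}\le L_{\mathrm c}$ for $M\in\mathbb{B}_1$ and $\|G\|_{\mathrm F,r}\le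 L_{\mathrm s}\|M-M^*\|_{\mathrm F}$ for $M\in\mathbb{B}_2$. RsGrad: from $M_0\in\mathbb{M}_r$, at each $l$ choose any $G_l\in\partial f(M_l)$, let $M_l=U_l\Sigma_lV_l^\top$ be the thin SVD, project onto the tangent space $\mathbb{T}_l$ at $M_l$, $\mathcal{P}_{\mathbb{T}_l}(G_l)=U_lU_l^\top G_l+G_lV_lV_l^\top-U_lU_l^\top G_lV_lV_l^\top$, and set $M_{l+1}=\mathrm{SVD}_r(M_l-\eta_l\mathcal{P}_{\mathbb{T}_l}(G_l))$.
   Formalization: The l-th iteration is restricted to those for which every earlier iterate has distance at least τ_s from M*; below τ_s no stepsize is prescribed, so an arbitrary step could throw the run far away and the claim would fail. *)

(* Defs.v *)
From HB Require Import structures.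
From mathcomp Require Import all_boot all_order all_algebra.
From mathcomp Require Import all_classical all_reals.

Set Implicit Arguments.
Unset Strict Implicit.
Unset Printing Implicit Defensive.

Import Order.TTheory GRing.Theory Num.Theory.

Local Open Scope classical_set_scope.
Local Open Scope ring_scope.

Section MatrixNotions.
Context {R : realType} {d1 d2 : nat}.
Implicit Types (r : nat) (A B G M N : 'M[R]_(d1, d2)).

(* The norm `|A| provided by MathComp-Analysis on matrices is the max norm, so
   the Frobenius structure is defined here. *)
Definition fdot A B : R := \sum_(i < d1) \sum_(j < d2) A i j * B i j.

Definition fnorm A : R := Num.sqrt (fdot A A).

Definition low_rank r : set 'M[R]_(d1, d2) := [set M | (\rank M <= r)%N].

(* N is a value of SVD_r(A).  It is a relation because the truncated SVD is not
   unique when the r-th and (r+1)-st singular values of A coincide. *)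
Definition is_svd_trunc r A N : Prop :=
  low_rank r N /\ forall N', low_rank r N' -> fnorm (A - N) <= fnorm (A - N').

Definition svd_trunc r A : 'M[R]_(d1, d2) := xget 0 (is_svd_trunc r A).

(* The choice made by svd_trunc is immaterial here: all best rank-r
   approximations N of A satisfy fnorm N ^+ 2 = fnorm A ^+ 2 - fnorm (A - N) ^+ 2
   and hence have the same norm. *)
Definition fnorm_r r A : R := fnorm (svd_trunc r A).

Definition singular_values A : set R :=
  [set s | 0 <= s /\ eigenvalue (A^T *m A) (s ^+ 2)].

(* The set is finite, so inf is its minimum whenever A != 0. *)
Definition sigma_min A : R := inf (singular_values A `&` [set s | 0 < s]).

(* Thin SVD with factors of width r; zero singular values are allowed, so that
   it also covers matrices of rank less than r. *)
Definition is_thin_svd r A (U : 'M[R]_(d1, r)) (s : 'rV[R]_r)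
    (V : 'M[R]_(d2, r)) : Prop :=
  [/\ U^T *m U = 1%:M, V^T *m V = 1%:M,
      forall i, 0 <= s 0 i,
      forall i j : 'I_r, (i <= j)%N -> s 0 j <= s 0 i
    & A = U *m diag_mx s *m V^T].

Definition tangent_proj r (U : 'M[R]_(d1, r)) (V : 'M[R]_(d2, r)) G :
    'M[R]_(d1, d2) :=
  U *m U^T *m G + G *m V *m V^T - U *m U^T *m G *m V *m V^T.

Definition subdifferential (f : 'M[R]_(d1, d2) -> R) M : set 'M[R]_(d1, d2) :=
  [set G | forall M', f M + fdot G (M' - M) <= f M'].

Definition phase_one_set r Mstar (tauc : R) : set 'M[R]_(d1, d2) :=
  [set M | low_rank r M /\ tauc <= fnorm (M - Mstar)].

Definition phase_two_set r Mstar (tauc taus : R) : set 'M[R]_(d1, d2) :=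
  [set M | low_rank r M /\ taus <= fnorm (M - Mstar) < tauc].

Record two_phase_regular r (f : 'M[R]_(d1, d2) -> R) Mstar
    (tauc taus muc mus Lc Ls : R) : Prop := TwoPhaseRegular {
  sharp_phase_one : forall M, phase_one_set r Mstar tauc M ->
    muc * fnorm (M - Mstar) <= f M - f Mstar;
  sharp_phase_two : forall M, phase_two_set r Mstar tauc taus M ->
    mus * fnorm (M - Mstar) ^+ 2 <= f M - f Mstar;
  subgrad_phase_one : forall M G, phase_one_set r Mstar tauc M ->
    subdifferential f M G -> fnorm_r r G <= Lc;
  subgrad_phase_two : forall M G, phase_two_set r Mstar tauc taus M ->
    subdifferential f M G -> fnorm_r r G <= Ls * fnorm (M - Mstar)
}.

(* A single step is nondeterministic in the sub-gradient, in the thin SVD and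
   in the truncated SVD. *)
Definition rsgrad_step r (f : 'M[R]_(d1, d2) -> R) (eta : R) M M' : Prop :=
  exists G (U : 'M[R]_(d1, r)) (s : 'rV[R]_r) (V : 'M[R]_(d2, r)),
    [/\ subdifferential f M G, is_thin_svd M U s V
      & is_svd_trunc r (M - eta *: tangent_proj U V G) M'].

Definition rsgrad r (f : 'M[R]_(d1, d2) -> R) (eta : nat -> R)
    (M : nat -> 'M[R]_(d1, d2)) : Prop :=
  low_rank r (M 0%N) /\ forall l, rsgrad_step r f (eta l) (M l) (M l.+1).

End MatrixNotions.

(* Main.v *)
Require Import Defs.
From HB Require Import structures.
From mathcomp Require Import all_boot all_order all_algebra.
From mathcomp Require Import all_classical all_reals.
From mathcomp Require Import topology normedtype derive.
From mathcomp Require Import ring lra.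

(** The proof follows the distance D to Mstar (called A below) through one
    iteration.  Write W for the point M - eta P_T(G) reached before the final
    truncation, sigma for the smallest positive singular value of A, and L for
    a bound on the r-truncated norm of G.

    The inner product of G with M - A is at least f M - f A, hence at least
    mu D.  Passing from G to its tangent projection only loses the inner product
    of G with the normal component of A, a matrix of rank at most r whose norm
    is at most D^2 / sigma ([curvature_bound]).  The truncated norm controls
    inner products with matrices of rank at most r ([fdot_le_fnorm_r]), so
    the loss is at most L D^2 / sigma, and the same fact bounds the norm of
    P_T(G) by sqrt 2 L.  Expanding the square,
      |W - A|^2 <= D^2 - 2 eta (mu D - L D^2 / sigma) + 2 eta^2 L^2.

    Truncation could in general double the error.  It does not here because W
    lies on the tangent space of the matrices of rank r at M, so that an explicit
    matrix of rank at most r sits within O(eta^2 L^2 / sigma) of W; the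
    truncation, being a best approximation, is at least as close
    ([svd_retraction_second_order]).  All singular values of M are at least
    sigma / 2 by a Weyl-type inequality ([thin_svd_gap]).

    With t = mu^2 / L^2 and D at most sigma t / 100, both curvature terms are
    small multiples of t, and the stepsizes of either phase give the contraction
    factor 1 - t / 25 ([rsgrad_step_contraction]).  Phase two is phase one with
    mu D and L D in place of mu and L.  The inequality t <= 2
    ([sharpness_ratio_le2]) keeps these factors nonnegative, and the theorem
    follows by induction, since phase two is never left for phase one.

    Two facts come from compactness: the existence of best approximations of
    given rank, and the inequality |x A^T| >= sigma |x| for x in the row space
    of A, whose minimizer on the unit sphere is an eigenvector of A^T A. *)

Set Implicit Arguments.
Unset Strict Implicit.
Unset Printing Implicit Defensive.

Import Order.TTheory GRing.Theory Num.Theory.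
Import numFieldNormedType.Exports.
Local Open Scope ring_scope.

(** * Frobenius inner product and norm *)

Section Frobenius.
Context {R : realType}.
Implicit Types m n p : nat.

Lemma fdotE m n (A B : 'M[R]_(m, n)) : fdot A B = \tr (A *m B^T).
Proof.
apply: eq_bigr => i _; rewrite mxE; apply: eq_bigr => j _.
by rewrite mxE.
Qed.

Lemma fdotC m n (A B : 'M[R]_(m, n)) : fdot A B = fdot B A.
Proof. by apply: eq_bigr => i _; apply: eq_bigr => j _; rewrite mulrC. Qed.

Lemma fdot_tr m n (A B : 'M[R]_(m, n)) : fdot A^T B^T = fdot A B.
Proof. by rewrite !fdotE trmxK mxtrace_mulC -mxtrace_tr trmx_mul trmxK. Qed.

Lemma fdotDl m n (A B C : 'M[R]_(m, n)) : fdot (A + B) C = fdot A C + fdot B C.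
Proof. by rewrite !fdotE mulmxDl raddfD. Qed.

Lemma fdotZl m n a (A B : 'M[R]_(m, n)) : fdot (a *: A) B = a * fdot A B.
Proof. by rewrite !fdotE -scalemxAl linearZ. Qed.

Lemma fdotNl m n (A B : 'M[R]_(m, n)) : fdot (- A) B = - fdot A B.
Proof. by rewrite -scaleN1r fdotZl mulN1r. Qed.

Lemma fdotBl m n (A B C : 'M[R]_(m, n)) : fdot (A - B) C = fdot A C - fdot B C.
Proof. by rewrite fdotDl fdotNl. Qed.

Lemma fdotDr m n (A B C : 'M[R]_(m, n)) : fdot C (A + B) = fdot C A + fdot C B.
Proof. by rewrite fdotC fdotDl !(fdotC _ C). Qed.

Lemma fdotZr m n a (A B : 'M[R]_(m, n)) : fdot A (a *: B) = a * fdot A B.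
Proof. by rewrite fdotC fdotZl (fdotC B). Qed.

Lemma fdotNr m n (A B : 'M[R]_(m, n)) : fdot A (- B) = - fdot A B.
Proof. by rewrite fdotC fdotNl (fdotC B). Qed.

Lemma fdotBr m n (A B C : 'M[R]_(m, n)) : fdot C (A - B) = fdot C A - fdot C B.
Proof. by rewrite fdotDr fdotNr. Qed.

Lemma fdot0l m n (A : 'M[R]_(m, n)) : fdot 0 A = 0.
Proof. by rewrite fdotE mul0mx mxtrace0. Qed.

Lemma fdot_mulmxl m n p (C : 'M[R]_(m, n)) (A : 'M[R]_(n, p)) (B : 'M[R]_(m, p)) :
  fdot (C *m A) B = fdot A (C^T *m B).
Proof. by rewrite !fdotE trmx_mul trmxK -mulmxA mxtrace_mulC !mulmxA. Qed.

Lemma fdot_mulmxr m n p (A : 'M[R]_(m, n)) (C : 'M[R]_(n, p)) (B : 'M[R]_(m, p)) :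
  fdot (A *m C) B = fdot A (B *m C^T).
Proof. by rewrite !fdotE trmx_mul trmxK !mulmxA. Qed.

Lemma fdot_ge0 m n (A : 'M[R]_(m, n)) : 0 <= fdot A A.
Proof. by apply: sumr_ge0 => i _; apply: sumr_ge0 => j _; rewrite -expr2 sqr_ge0. Qed.

Lemma fdot_eq0 m n (A : 'M[R]_(m, n)) : fdot A A = 0 -> A = 0.
Proof.
move=> A0; apply/matrixP => i j; rewrite mxE; apply/eqP.
have ge0 k : 0 <= \sum_l A k l * A k l.
  by apply: sumr_ge0 => l _; rewrite -expr2 sqr_ge0.
move/eqP: A0; rewrite psumr_eq0 => [/allP /(_ i)|k _]; last exact: ge0.
rewrite mem_index_enum => /(_ isT) /=; rewrite psumr_eq0; last first.
  by move=> k _; rewrite -expr2 sqr_ge0.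
by move=> /allP /(_ j); rewrite mem_index_enum -expr2 sqrf_eq0 => /(_ isT).
Qed.

Lemma fnorm_ge0 m n (A : 'M[R]_(m, n)) : 0 <= fnorm A.
Proof. exact: sqrtr_ge0. Qed.

Lemma fnorm_sqr m n (A : 'M[R]_(m, n)) : fnorm A ^+ 2 = fdot A A.
Proof. by rewrite sqr_sqrtr // fdot_ge0. Qed.

Lemma fnorm_eq0 m n (A : 'M[R]_(m, n)) : fnorm A = 0 -> A = 0.
Proof. by move=> A0; apply: fdot_eq0; rewrite -fnorm_sqr A0 expr0n. Qed.

Lemma fnorm0 m n : fnorm (0 : 'M[R]_(m, n)) = 0.
Proof. by rewrite /fnorm fdot0l sqrtr0. Qed.

Lemma fnormN m n (A : 'M[R]_(m, n)) : fnorm (- A) = fnorm A.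
Proof. by rewrite /fnorm fdotNl fdotNr opprK. Qed.

Lemma fnormBC m n (A B : 'M[R]_(m, n)) : fnorm (A - B) = fnorm (B - A).
Proof. by rewrite -fnormN opprB. Qed.

Lemma fnorm_tr m n (A : 'M[R]_(m, n)) : fnorm A^T = fnorm A.
Proof. by rewrite /fnorm fdot_tr. Qed.

Lemma fnormZ m n a (A : 'M[R]_(m, n)) : fnorm (a *: A) = `|a| * fnorm A.
Proof.
by rewrite /fnorm fdotZl fdotZr mulrA -expr2 sqrtrM ?sqr_ge0 // sqrtr_sqr.
Qed.

Lemma fnorm_le m n p q (A : 'M[R]_(m, n)) (B : 'M[R]_(p, q)) :
  (fnorm A <= fnorm B) = (fdot A A <= fdot B B).
Proof. by rewrite -!fnorm_sqr ler_sqr // nnegrE fnorm_ge0. Qed.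

Lemma fdot_le_fnorm m n (A B : 'M[R]_(m, n)) : fdot A B <= fnorm A * fnorm B.
Proof.
have a0 := fnorm_ge0 A; have b0 := fnorm_ge0 B.
have [/eqP ab0|ab0] := eqVneq (fnorm A * fnorm B) 0.
  move: ab0; rewrite mulf_eq0 => /orP [] /eqP/fnorm_eq0 ->.
    by rewrite fdot0l mulr_ge0 ?fnorm_ge0.
  by rewrite fdotC fdot0l mulr_ge0 ?fnorm_ge0.
have ab : 0 < fnorm A * fnorm B by rewrite lt_def ab0 mulr_ge0.
(* This combination of A and B vanishes in the equality case. *)
have := fdot_ge0 (fnorm B *: A - fnorm A *: B).
rewrite !(fdotBl, fdotBr, fdotZl, fdotZr) (fdotC B A) -!fnorm_sqr => h.
rewrite -(ler_pM2l ab); nra.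
Qed.

Lemma fnormD m n (A B : 'M[R]_(m, n)) : fnorm (A + B) <= fnorm A + fnorm B.
Proof.
rewrite -ler_sqr ?nnegrE ?addr_ge0 ?fnorm_ge0 //.
rewrite sqrrD !fnorm_sqr fdotDl !fdotDr (fdotC B A).
have := fdot_le_fnorm A B; lra.
Qed.

Lemma fnormB_sqr m n (A B : 'M[R]_(m, n)) :
  fnorm (A - B) ^+ 2 = fnorm A ^+ 2 - 2 * fdot A B + fnorm B ^+ 2.
Proof. by rewrite !fnorm_sqr fdotBl !fdotBr (fdotC B A); ring. Qed.

Lemma fnorm_triangle m n (A B C : 'M[R]_(m, n)) :
  fnorm (A - C) <= fnorm (A - B) + fnorm (B - C).
Proof. by rewrite -[A - C](subrKA B) fnormD. Qed.

(** Each entry of the product is an inner product of a row of A with a column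
    of B, to which the Cauchy-Schwarz inequality applies. *)
Lemma fnormM m n p (A : 'M[R]_(m, n)) (B : 'M[R]_(n, p)) :
  fnorm (A *m B) <= fnorm A * fnorm B.
Proof.
rewrite -ler_sqr ?nnegrE ?mulr_ge0 ?fnorm_ge0 // exprMn !fnorm_sqr.
rewrite -[fdot B B]fdot_tr.
have entry i j : ((A *m B) i j) ^+ 2 <=
    (\sum_k A i k * A i k) * (\sum_k B^T j k * B^T j k).
  have rowE q (X : 'M[R]_(q, n)) k :
      \sum_l X k l * X k l = fnorm (row k X) ^+ 2.
    rewrite fnorm_sqr /fdot big_ord1.
    by apply: eq_bigr => l _; rewrite !mxE.
  have -> : (A *m B) i j = fdot (row i A) (row j B^T).
    by rewrite /fdot big_ord1 mxE; apply: eq_bigr => k _; rewrite !mxE.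
  rewrite !rowE -exprMn -ler_sqrt ?sqr_ge0 // !sqrtr_sqr.
  rewrite (ger0_norm (mulr_ge0 _ _)) ?fnorm_ge0 // ler_norml fdot_le_fnorm andbT.
  by rewrite lerNl -fdotNl -(fnormN (row i A)) fdot_le_fnorm.
rewrite /fdot mulr_suml; apply: ler_sum => i _.
by rewrite mulr_sumr; apply: ler_sum => j _; rewrite -expr2.
Qed.

Lemma fnorm_orthl m n p (U : 'M[R]_(m, n)) (A : 'M[R]_(n, p)) :
  U^T *m U = 1%:M -> fnorm (U *m A) = fnorm A.
Proof. by move=> UU; rewrite /fnorm fdot_mulmxl mulmxA UU mul1mx. Qed.

Lemma fnorm_orthr m n p (V : 'M[R]_(m, n)) (A : 'M[R]_(p, n)) :
  V^T *m V = 1%:M -> fnorm (A *m V^T) = fnorm A.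
Proof. by move=> VV; rewrite -fnorm_tr trmx_mul trmxK fnorm_orthl // fnorm_tr. Qed.

Definition orth_proj n (P : 'M[R]_n) := P^T = P /\ P *m P = P.

Lemma orth_projU m n (U : 'M[R]_(m, n)) :
  U^T *m U = 1%:M -> orth_proj (U *m U^T).
Proof.
by move=> UU; split; rewrite ?trmx_mul ?trmxK // !mulmxA -(mulmxA U) UU mulmx1.
Qed.

Lemma orth_projC n (P : 'M[R]_n) : orth_proj P -> orth_proj (1%:M - P).
Proof.
move=> [PT PP]; split; first by rewrite linearB /= trmx1 PT.
by rewrite mulmxBl mul1mx mulmxBr mulmx1 PP subrr subr0.
Qed.

(** The ranges of P and 1 - P are orthogonal. *)
Lemma pythagoras m n (P : 'M[R]_m) (A B : 'M[R]_(m, n)) : orth_proj P ->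
  fnorm (P *m A + (1%:M - P) *m B) ^+ 2 =
  fnorm (P *m A) ^+ 2 + fnorm ((1%:M - P) *m B) ^+ 2.
Proof.
move=> [PT PP]; rewrite !fnorm_sqr fdotDl !fdotDr.
have -> : fdot (P *m A) ((1%:M - P) *m B) = 0.
  rewrite fdotC fdot_mulmxl mulmxA linearB /= trmx1 PT.
  by rewrite mulmxBl mul1mx PP subrr mul0mx fdotC fdot0l.
have -> : fdot ((1%:M - P) *m B) (P *m A) = 0.
  rewrite fdot_mulmxl mulmxA linearB /= trmx1 PT.
  by rewrite mulmxBl mul1mx PP subrr mul0mx fdotC fdot0l.
by rewrite addr0 add0r.
Qed.

Lemma fnorm_projl m n (P : 'M[R]_m) (A : 'M[R]_(m, n)) : orth_proj P ->
  fnorm (P *m A) <= fnorm A.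
Proof.
move=> PP; rewrite -ler_sqr ?nnegrE ?fnorm_ge0 //.
have := pythagoras A A PP.
rewrite -mulmxDl subrKC mul1mx => ->.
by rewrite lerDl sqr_ge0.
Qed.

Lemma fnorm_projr m n (P : 'M[R]_n) (A : 'M[R]_(m, n)) : orth_proj P ->
  fnorm (A *m P) <= fnorm A.
Proof.
by move=> PP; rewrite -fnorm_tr trmx_mul PP.1 -(fnorm_tr A) fnorm_projl.
Qed.

End Frobenius.

(** * Best approximation of bounded rank *)

Section Minimum.
Context {R : realType}.
Implicit Types m n r : nat.

Lemma fnorm_mxvec m n (A : 'M[R]_(m, n)) : fnorm (mxvec A) = fnorm A.
Proof.
rewrite /fnorm; congr Num.sqrt; rewrite /fdot big_ord1 pair_bigA /=.
rewrite (reindex _ (curry_mxvec_bij m n)) /=.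
by apply: eq_bigr => -[i j] _; rewrite mxvecE.
Qed.

Lemma normr_le_fnorm n (x : 'rV[R]_n) : `|x| <= fnorm x.
Proof.
rewrite /Num.Def.normr /= mx_normrE; apply: bigmax_le => [|[i j] _ /=].
  exact: fnorm_ge0.
rewrite -(ler_sqr (normr_ge0 _) (fnorm_ge0 x)) fnorm_sqr /fdot big_ord1 ord1.
rewrite real_normK ?num_real // (bigD1 j) //= -expr2 lerDl.
by apply: sumr_ge0 => k _; rewrite -expr2 sqr_ge0.
Qed.

Lemma fnorm_le_normr n (x : 'rV[R]_n) : fnorm x <= n%:R * `|x|.
Proof.
have entry j : `|x 0 j| <= `|x|.
  by rewrite [leRHS]/Num.Def.normr /= mx_normrE; apply/bigmax_geP; right; exists (0, j).
have n0 : 0 <= n%:R :> R by [].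
rewrite -ler_sqr ?nnegrE ?fnorm_ge0 ?mulr_ge0 // fnorm_sqr /fdot big_ord1.
have : \sum_(j < n) x 0 j * x 0 j <= \sum_(j < n) `|x| ^+ 2.
  by apply: ler_sum => j _; rewrite -expr2 -(real_normK (num_real _)) ler_sqr ?nnegrE.
move=> /le_trans; apply; rewrite sumr_const card_ord -[leLHS]mulr_natl exprMn.
rewrite ler_wpM2r ?sqr_ge0 // expr2 -natrM ler_nat.
by case: (n) => // k; rewrite leq_pmulr.
Qed.

(** Closedness is phrased with the Frobenius norm and continuity as a Lipschitz
    bound, so that the topology of matrices, which is that of the max norm, only
    enters here.  Matrices are flattened to row vectors, for which bounded closed
    sets are known to be compact. *)
Lemma fnorm_min_attained m n (K : set 'M[R]_(m, n)) (F : 'M[R]_(m, n) -> R)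
    (b k : R) :
  (exists X, K X) -> (forall X, K X -> fnorm X <= b) ->
  (forall X, ~ K X -> exists2 e : R, 0 < e & forall Y, fnorm (X - Y) < e -> ~ K Y) ->
  0 <= k -> (forall X Y, F X <= F Y + k * fnorm (X - Y)) ->
  exists2 X, K X & forall Y, K Y -> F X <= F Y.
Proof.
move=> [X0 KX0] Kb Kcl k0 FL.
pose K' : set 'rV[R]_(m * n) := [set x | K (vec_mx x)]%classic.
have vecB (x y : 'rV[R]_(m * n)) :
    fnorm (vec_mx x - vec_mx y : 'M[R]_(m, n)) <= (m * n)%:R * `|x - y|.
  by rewrite -linearB -fnorm_mxvec vec_mxK fnorm_le_normr.
have cK' : compact K'.
  apply: bounded_closed_compact.
    exists b; split; first exact: num_real.
    move=> c bc x /= Kx; apply: le_trans (normr_le_fnorm _) _.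
    by apply: le_trans (ltW bc); rewrite -[x]vec_mxK fnorm_mxvec Kb.
  rewrite -openC openE => x /= /Kcl[e e0 he]; rewrite /interior /=.
  apply/(@nbhs_normP R 'rV[R]_(m * n)); exists (e / ((m * n)%:R + 1)) => /=.
    by rewrite divr_gt0 // ltr_wpDl.
  move=> y /= xy; apply: he; apply: le_lt_trans (vecB _ _) _.
  have N1 : 0 < (m * n)%:R + 1 :> R by rewrite ltr_wpDl.
  move: xy; rewrite ltr_pdivlMr // => xy.
  by apply: le_lt_trans xy; rewrite mulrC ler_wpM2l // lerDl.
have cF : continuous (F \o (vec_mx : 'rV[R]_(m * n) -> 'M[R]_(m, n))).
  move=> x A /(@nbhs_normP R R^o)[e /= e0 he].
  pose c := k * (m * n)%:R + 1.
  have c0 : 0 < c by rewrite ltr_wpDl // mulr_ge0.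
  apply/(@nbhs_normP R 'rV[R]_(m * n)); exists (e / c) => /=; first by rewrite divr_gt0.
  move=> y /=; rewrite ltr_pdivlMr // => xy; apply: he => /=.
  have hk : k * fnorm (vec_mx x - vec_mx y : 'M[R]_(m, n)) < e.
    apply: le_lt_trans xy; apply: le_trans (ler_wpM2l k0 (vecB x y)) _.
    by rewrite mulrA mulrC ler_wpM2l // lerDl.
  have := FL (vec_mx x) (vec_mx y); have := FL (vec_mx y) (vec_mx x).
  rewrite (fnormBC (vec_mx y)) => h1 h2.
  rewrite ltr_norml; apply/andP; split; lra.
have K'0 : (K' !=set0)%classic.
  by exists (mxvec X0); rewrite /K' /= mxvecK.
have [c] := EVT_min_rV K'0 cK' (continuous_subspaceT cF).
rewrite inE => Kc hc; exists (vec_mx c) => // Y KY.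
have := hc (mxvec Y); rewrite inE /K' /= mxvecK; exact.
Qed.

(** A factorization A X B = 1 witnesses the rank of X.  If Y had rank at most r,
    some nonzero z would satisfy z A Y B = 0, hence z = z A (X - Y) B, which
    bounds X - Y from below. *)
Lemma rank_lower_semicontinuous m n r (X : 'M[R]_(m, n)) : (r < \rank X)%N ->
  exists2 e : R, 0 < e & forall Y, fnorm (X - Y) < e -> (r < \rank Y)%N.
Proof.
move=> rX.
have /row_freeP[B XB] := row_base_free X.
have /row_fullP[A AX] := col_base_full X.
have AXB : A *m X *m B = 1%:M.
  have -> : A *m X = row_base X.
    by rewrite -[X in _ *m X]mulmx_base mulmxA AX mul1mx.
  exact: XB.
exists (fnorm A * fnorm B + 1)^-1.
  by rewrite invr_gt0 ltr_wpDl // mulr_ge0 ?fnorm_ge0.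
move=> Y XY; rewrite ltnNge; apply/negP => rY.
have : ~~ row_free (A *m Y *m B).
  rewrite -row_leq_rank -ltnNge; apply: leq_ltn_trans rX.
  by apply: leq_trans rY; apply: leq_trans (mxrankM_maxl _ _) (mxrankM_maxr _ _).
rewrite -kermx_eq0 => /rowV0Pn[z /sub_kermxP zK z0].
have zE : z = z *m A *m (X - Y) *m B.
  rewrite -!mulmxA mulmxBl mulmxBr mulmxBr.
  by rewrite (mulmxA A Y) zK subr0 (mulmxA A X) AXB mulmx1.
have c0 : 0 < fnorm A * fnorm B + 1 by rewrite ltr_wpDl // mulr_ge0 ?fnorm_ge0.
have z1 : 0 < fnorm z.
  rewrite lt_def fnorm_ge0 andbT; apply: contra z0 => /eqP h.
  by apply/eqP; apply: fnorm_eq0.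
have : fnorm z <= fnorm z * (fnorm A * fnorm B) * fnorm (X - Y).
  rewrite {1}zE; apply: le_trans (fnormM _ _) _.
  have -> : fnorm z * (fnorm A * fnorm B) * fnorm (X - Y) =
    fnorm z * fnorm A * fnorm (X - Y) * fnorm B by ring.
  rewrite ler_wpM2r ?fnorm_ge0 //; apply: le_trans (fnormM _ _) _.
  by rewrite ler_wpM2r ?fnorm_ge0 // fnormM.
rewrite -mulrA ler_pMr // => ge1.
move: XY; rewrite -div1r ltr_pdivlMr // => XY.
have := fnorm_ge0 (X - Y); nra.
Qed.

(** The zero matrix is a candidate, so only matrices of norm at most twice that
    of G compete, and these form a compact set. *)
Lemma svd_trunc_exists m n r (G : 'M[R]_(m, n)) : exists N, is_svd_trunc r G N.
Proof.
pose K : set 'M[R]_(m, n) :=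
  [set X | low_rank r X /\ fnorm X <= 2 * fnorm G]%classic.
have [||X|||N [rN _] Nmin] := @fnorm_min_attained m n K
    (fun X => fnorm (G - X)) (2 * fnorm G) 1 _ _ _ _ _.
- exists 0; split; first by rewrite /low_rank /= mxrank0.
  by rewrite fnorm0 mulr_ge0 ?fnorm_ge0.
- by move=> X [].
- move=> KX; have [rX|rX] := leqP (\rank X) r.
    have XG : 2 * fnorm G < fnorm X.
      by rewrite ltNge; apply/negP => XG; apply: KX.
    exists (fnorm X - 2 * fnorm G) => [|Y XY [_ YG]]; first by rewrite subr_gt0.
    have := fnorm_triangle X Y 0; rewrite !subr0; lra.
  have [e e0 he] := rank_lower_semicontinuous rX.
  by exists e => // Y /he; rewrite ltnNge => /negP rY [].
- exact: ler01.
- move=> X Y; rewrite mul1r addrC (fnormBC X) addrC; exact: fnorm_triangle.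
exists N; split=> // X rX.
have [XG|XG] := leP (fnorm X) (2 * fnorm G); first exact: Nmin.
have := Nmin 0; rewrite subr0 => N0.
apply: le_trans (N0 _) _.
  split; first by rewrite /low_rank /= mxrank0.
  by rewrite fnorm0 mulr_ge0 ?fnorm_ge0.
have := fnorm_triangle X G 0; rewrite !subr0 (fnormBC X); lra.
Qed.

(** Existence is what makes [fnorm_r] meaningful: without it the value of
    [svd_trunc] would be the default 0. *)
Lemma svd_truncP m n r (G : 'M[R]_(m, n)) : is_svd_trunc r G (svd_trunc r G).
Proof. by have [N hN] := svd_trunc_exists r G; apply: xgetPex; exists N. Qed.

(** The matrices of rank at most r form a cone.  Let N be the truncation of G.
    Comparing N with the best multiple of B gives
    <G,B>^2 <= |B|^2 (|G|^2 - |G - N|^2), and comparing it with the multiples of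
    N itself gives |G|^2 - |G - N|^2 = |N|^2. *)
Lemma fdot_le_fnorm_r m n r (G B : 'M[R]_(m, n)) : (\rank B <= r)%N ->
  fdot G B <= fnorm_r r G * fnorm B.
Proof.
move=> rB; have [rN Nmin] := svd_truncP r G; rewrite /fnorm_r.
set N := svd_trunc r G in rN Nmin *.
have line C t : low_rank r C -> fnorm (G - N) ^+ 2 <=
    fnorm G ^+ 2 - 2 * t * fdot G C + t ^+ 2 * fnorm C ^+ 2.
  move=> rC; have : low_rank r (t *: C).
    by rewrite /low_rank /= (leq_trans (mxrank_scale _ _)).
  move=> /Nmin; rewrite -ler_sqr ?nnegrE ?fnorm_ge0 // => /le_trans; apply.
  by rewrite fnormB_sqr fdotZr fnormZ exprMn (real_normK (num_real _)) mulrA.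
have Bound C : low_rank r C ->
    fdot G C ^+ 2 <= fnorm C ^+ 2 * (fnorm G ^+ 2 - fnorm (G - N) ^+ 2).
  move=> rC; have [C0|C0] := eqVneq (fnorm C) 0.
    by rewrite (fnorm_eq0 C0) fdotC fdot0l fnorm0 !expr0n mul0r.
  have C1 : 0 < fnorm C ^+ 2 by rewrite exprn_gt0 // lt_def C0 fnorm_ge0.
  (* The minimizer of the quadratic polynomial in t bounded by line. *)
  have := line C (fdot G C / fnorm C ^+ 2) rC.
  have -> : fnorm G ^+ 2 - 2 * (fdot G C / fnorm C ^+ 2) * fdot G C +
     (fdot G C / fnorm C ^+ 2) ^+ 2 * fnorm C ^+ 2 =
     fnorm G ^+ 2 - fdot G C ^+ 2 / fnorm C ^+ 2 by field.
  move=> h; rewrite mulrC -ler_pdivrMr //; lra.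
have energy : fnorm G ^+ 2 - fnorm (G - N) ^+ 2 <= fnorm N ^+ 2.
  have := Bound N rN.
  have -> : fnorm (G - N) ^+ 2 = fnorm G ^+ 2 - 2 * fdot G N + fnorm N ^+ 2.
    exact: fnormB_sqr.
  move=> h; have : (fdot G N - fnorm N ^+ 2) ^+ 2 = 0.
    by apply/eqP; rewrite eq_le sqr_ge0 andbT; lra.
  move/eqP; rewrite sqrf_eq0 => /eqP; lra.
have := Bound B rB => /le_trans /(_ (ler_wpM2l (sqr_ge0 _) energy)).
rewrite -exprMn -ler_sqrt ?sqr_ge0 // !sqrtr_sqr.
rewrite [`|fnorm B * _|]ger0_norm ?mulr_ge0 ?fnorm_ge0 // mulrC.
by apply: le_trans; rewrite ler_norm.
Qed.

End Minimum.

(** * The smallest positive singular value *)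

Section Spectral.
Context {R : realType}.
Implicit Types m n r : nat.

(** Let y minimize |y A^T| over the unit vectors of the row space, with minimum
    mu.  The first variation of |z A^T|^2 - mu^2 |z|^2 at y in the direction
    w = y A^T A - mu^2 y, which stays in the row space, is 2 |w|^2, so w = 0 and y
    is an eigenvector of A^T A.  Moreover mu > 0, because A^T is injective on the
    row space, so mu is one of the values of which [sigma_min A] is the infimum. *)
Lemma sigma_min_le m n (A : 'M[R]_(m, n)) (x : 'rV[R]_n) : (x <= A)%MS ->
  sigma_min A * fnorm x <= fnorm (x *m A^T).
Proof.
move=> xA; have [x0|x0] := eqVneq (fnorm x) 0; first by rewrite x0 mulr0 fnorm_ge0.
have x1 : 0 < fnorm x by rewrite lt_def x0 fnorm_ge0.
pose K : set 'rV[R]_n := [set y | (y <= A)%MS /\ fnorm y = 1]%classic.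
have [||y|||y [yA y1] ymin] := @fnorm_min_attained R 1 n K
    (fun y => fnorm (y *m A^T)) 1 (fnorm A^T) _ _ _ _ _.
- exists ((fnorm x)^-1 *: x); split; first exact: scalemx_sub.
  by rewrite fnormZ ger0_norm ?invr_ge0 ?fnorm_ge0 // mulVf.
- by move=> y [_ ->].
- move=> Ky; have [yA|yA] := boolP (y <= A)%MS.
    exists `|fnorm y - 1|.
      rewrite normr_gt0 subr_eq0; apply/eqP => y1; exact: Ky.
    move=> z yz [_ z1]; move: yz; rewrite ltNge => /negP; apply.
    have := fnorm_triangle y z 0; have := fnorm_triangle z y 0.
    rewrite !subr0 z1 (fnormBC z) => h1 h2.
    rewrite ler_norml; apply/andP; split; lra.
  have c0 : 0 < fnorm (y *m cokermx A).
    rewrite lt_def fnorm_ge0 andbT; apply: contra yA => /eqP/fnorm_eq0.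
    by rewrite submxE => ->.
  have b0 := fnorm_ge0 (cokermx A).
  exists (fnorm (y *m cokermx A) / (fnorm (cokermx A) + 1)).
    by rewrite divr_gt0 // ltr_wpDl.
  move=> z; rewrite ltr_pdivlMr ?ltr_wpDl // => yz [zA _].
  have : fnorm ((y - z) *m cokermx A) <= fnorm (y - z) * fnorm (cokermx A).
    exact: fnormM.
  rewrite mulmxBl; move: zA; rewrite submxE => /eqP ->; rewrite subr0.
  have := fnorm_ge0 (y - z); nra.
- exact: fnorm_ge0.
- move=> y z; have := fnorm_triangle (y *m A^T) (z *m A^T) 0.
  rewrite !subr0 -mulmxBl => /le_trans; apply.
  by rewrite addrC lerD2l mulrC fnormM.
set mu := fnorm (y *m A^T) in ymin.
have mu0 : 0 <= mu by exact: fnorm_ge0.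
have muP (z : 'rV[R]_n) : (z <= A)%MS -> mu * fnorm z <= fnorm (z *m A^T).
  move=> zA; have [z0|z0] := eqVneq (fnorm z) 0.
    by rewrite z0 mulr0 fnorm_ge0.
  have z1 : 0 < fnorm z by rewrite lt_def z0 fnorm_ge0.
  have := ymin ((fnorm z)^-1 *: z); rewrite -scalemxAl !fnormZ.
  rewrite ger0_norm ?invr_ge0 ?fnorm_ge0 // => h.
  rewrite -ler_pdivlMr // mulrC; apply: h; split; last first.
    by rewrite fnormZ ger0_norm ?invr_ge0 ?fnorm_ge0 // mulVf.
  exact: scalemx_sub.
have [w wE] : {w | w = y *m A^T *m A - mu ^+ 2 *: y} by eexists.
have wA : (w <= A)%MS.
  by rewrite wE addmx_sub ?submxMl // -scaleNr scalemx_sub.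
have quad (z : 'rV[R]_n) : (z <= A)%MS ->
    mu ^+ 2 * fdot z z <= fdot (z *m A^T) (z *m A^T).
  move=> zA; rewrite -!fnorm_sqr -exprMn ler_sqr ?nnegrE ?mulr_ge0 ?fnorm_ge0 //.
  exact: muP.
pose b := fdot (w *m A^T) (w *m A^T) - mu ^+ 2 * fdot w w.
have b0 : 0 <= b by rewrite subr_ge0 quad.
have variation t : 0 <= 2 * t * fdot w w + t ^+ 2 * b.
  have : mu ^+ 2 * fdot (y + t *: w) (y + t *: w) <=
      fdot ((y + t *: w) *m A^T) ((y + t *: w) *m A^T).
    by apply: quad; rewrite addmx_sub // scalemx_sub.
  rewrite mulmxDl -scalemxAl !(fdotDl, fdotDr, fdotZl, fdotZr).
  rewrite (fdotC w y) (fdotC (w *m A^T) (y *m A^T)).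
  have -> : fdot (y *m A^T) (w *m A^T) = fdot w w + mu ^+ 2 * fdot y w.
    rewrite fdotC fdot_mulmxr trmxK fdotC.
    by rewrite -[y *m A^T *m A](subrK (mu ^+ 2 *: y)) -wE fdotDl fdotZl.
  have -> : fdot (y *m A^T) (y *m A^T) = mu ^+ 2 by rewrite -fnorm_sqr.
  have -> : fdot y y = 1 by rewrite -fnorm_sqr y1 expr1n.
  rewrite /b; set e := fdot y w; set f := fdot w w.
  set g := fdot (w *m A^T) _; move=> h.
  rewrite -subr_ge0 in h; apply: le_trans h _; rewrite le_eqVlt; apply/orP; left.
  by apply/eqP; ring.
have w0 : w = 0.
  apply: fdot_eq0; have c0 : 0 < b + 1 by rewrite ltr_wpDl.
  (* Any small negative step would do; b may be zero, hence the b + 1. *)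
  have := variation (- (fdot w w / (b + 1))).
  set a := fdot w w.
  have -> : 2 * (- (a / (b + 1))) * a + (- (a / (b + 1))) ^+ 2 * b =
    - (a ^+ 2 * (b + 2) / (b + 1) ^+ 2) by field; rewrite gt_eqF.
  rewrite oppr_ge0 ler_pdivrMr ?exprn_gt0 // mul0r => h.
  apply/eqP; rewrite -sqrf_eq0 eq_le sqr_ge0 andbT.
  have b2 : 0 < b + 2 by rewrite ltr_wpDl.
  by rewrite -(ler_pM2r b2) mul0r.
have y0 : y != 0.
  by apply/eqP => y0; move: y1; rewrite y0 fnorm0 => /eqP; rewrite eq_sym oner_eq0.
have mu1 : 0 < mu.
  rewrite lt_def mu0 andbT; apply: contra y0 => /eqP/fnorm_eq0 yA0.
  apply/eqP; apply: fdot_eq0.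
  have /submxP[z yz] := yA.
  by rewrite {2}yz fdotC fdot_mulmxr yA0 fdotC fdot0l.
apply: le_trans (muP _ xA); rewrite ler_wpM2r ?fnorm_ge0 //.
apply: ge_inf; first by exists 0 => s [[]].
split=> //; split=> //; apply/eigenvalueP; exists y => //.
by apply/eqP; rewrite -subr_eq0 mulmxA -wE; apply/eqP.
Qed.

(** If z A A^T = 0 then |z A|^2 = 0; hence A A^T has the rank of A. *)
Lemma row_gram m n (A : 'M[R]_(m, n)) : (A^T <= A *m A^T)%MS.
Proof.
have rk : \rank (A *m A^T) = \rank A^T.
  apply/eqP; rewrite eqn_leq mxrankM_maxr /= mxrank_tr.
  have := mxrank_mul_ker A A^T; set I := (A :&: _)%MS => <-.
  suff -> : I = 0 by rewrite mxrank0 addn0.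
  apply/eqP; rewrite -submx0; apply/row_subP => i; rewrite submx0.
  have : (row i I <= I)%MS by exact: row_sub.
  rewrite sub_capmx => /andP[/submxP[z zA] /sub_kermxP k0].
  by apply/eqP; apply: fdot_eq0; rewrite {2}zA fdotC fdot_mulmxr k0 fdotC fdot0l.
have /geq_leqif := mxrank_leqif_sup (submxMl A A^T).
by rewrite rk leqnn => /esym.
Qed.

End Spectral.

(** * Geometry of matrices of bounded rank *)

Section Geometry.
Context {R : realType}.
Implicit Types m n p r : nat.

Lemma sigma_min_le_mx m n p (A : 'M[R]_(m, n)) (Y : 'M[R]_(p, n)) :
  (Y <= A)%MS -> sigma_min A * fnorm Y <= fnorm (Y *m A^T).
Proof.
move=> YA; have [s0|s0] := leP (sigma_min A) 0.
  apply: le_trans (fnorm_ge0 _); rewrite -oppr_ge0 -mulNr.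
  by rewrite mulr_ge0 ?oppr_ge0 ?fnorm_ge0.
rewrite -ler_sqr ?nnegrE ?fnorm_ge0 ?mulr_ge0 ?fnorm_ge0 ?(ltW s0) //.
have rows q (X : 'M[R]_(p, q)) :
    fnorm X ^+ 2 = \sum_i fnorm (row i X) ^+ 2.
  rewrite fnorm_sqr; apply: eq_bigr => i _; rewrite fnorm_sqr /fdot big_ord1.
  by apply: eq_bigr => j _; rewrite !mxE.
rewrite exprMn !rows mulr_sumr; apply: ler_sum => i _.
rewrite -exprMn ler_sqr ?nnegrE ?fnorm_ge0 ?mulr_ge0 ?fnorm_ge0 ?(ltW s0) //.
by rewrite row_mul sigma_min_le // (submx_trans (row_sub _ _)).
Qed.

Lemma fnorm_orth_mulr m n p (V : 'M[R]_(m, n)) (A : 'M[R]_(p, m)) :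
  V^T *m V = 1%:M -> fnorm (A *m V) <= fnorm A.
Proof.
move=> VV; rewrite -(fnorm_orthr _ VV) -mulmxA.
exact/fnorm_projr/orth_projU.
Qed.

(** The row space of A has dimension r, so it contains a nonzero x orthogonal to
    all right singular vectors of M but the i-th one.  Then
    |x M^T| <= s_i |x|, while |x A^T| >= sigma |x|. *)
Lemma thin_svd_gap m n r (A M : 'M[R]_(m, n)) U s V (i : 'I_r) :
  \rank A = r -> is_thin_svd M U s V ->
  sigma_min A - fnorm (M - A) <= s 0 i.
Proof.
move=> rA [UU VV s0 _ ME].
have : ~~ row_free (row_base A *m col' i V).
  rewrite -row_leq_rank -ltnNge; apply: leq_ltn_trans (rank_leq_col _) _.
  by rewrite [X in (_ < X)%N]rA (ltn_predK (ltn_ord i)).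
rewrite -kermx_eq0 => /rowV0Pn[z /sub_kermxP zV z0].
pose x := z *m row_base A.
have xA : (x <= A)%MS by rewrite (submx_trans (submxMl _ _)) ?eq_row_base.
have x0 : 0 < fnorm x.
  rewrite lt_def fnorm_ge0 andbT; apply: contra z0 => /eqP/fnorm_eq0 x0.
  by apply/eqP/(row_free_inj (row_base_free A)); rewrite mul0mx.
have xM : fnorm (x *m M^T) = s 0 i * fnorm (x *m V).
  rewrite ME !trmx_mul trmxK tr_diag_mx !mulmxA.
  rewrite fnorm_orthr // -[s 0 i](ger0_norm (s0 i)) -fnormZ.
  congr fnorm; rewrite mul_mx_diag; apply/rowP => j.
  rewrite [LHS]mxE [RHS]mxE.
  have [k ->|->] := unliftP i j; last by rewrite mulrC.
  have -> : (x *m V) 0 (lift i k) = (x *m col' i V) 0 k.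
    by rewrite !mxE; apply: eq_bigr => l _; rewrite [col' i V l k]mxE.
  by rewrite /x -mulmxA zV mxE mul0r mulr0.
have h1 := sigma_min_le xA.
have h2 : fnorm (x *m A^T) <= fnorm x * fnorm (M - A) + s 0 i * fnorm x.
  have -> : x *m A^T = x *m (A - M)^T + x *m M^T.
    by rewrite linearB /= mulmxBr subrK.
  apply: le_trans (fnormD _ _) _; apply: lerD.
    by rewrite fnormBC -(fnorm_tr (A - M)) fnormM.
  by rewrite xM ler_wpM2l // fnorm_orth_mulr.
rewrite -(ler_pM2r x0); nra.
Qed.

(** Since (1 - P) M = 0 = M (1 - Q), the normal component of A is
    (1 - P) (A - M) (1 - Q) as well as (1 - P) A (1 - Q).  Writing A (1 - Q)
    as A Y^T with the rows of Y in the row space of A, it is also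
    (1 - P) (A - M) Y^T, and sigma |Y| <= |A Y^T| = |(A - M) (1 - Q)| is at most
    |M - A| too. *)
Lemma curvature_bound m n (A M : 'M[R]_(m, n)) P Q :
  orth_proj P -> orth_proj Q -> P *m M = M -> M *m Q = M ->
  0 <= sigma_min A ->
  sigma_min A * fnorm ((1%:M - P) *m A *m (1%:M - Q)) <= fnorm (M - A) ^+ 2.
Proof.
move=> hP hQ PM MQ sig0.
have hP' := orth_projC hP; have hQ' := orth_projC hQ.
have /submxP[W WE] : ((1%:M - Q) *m A^T <= A *m A^T)%MS.
  exact: submx_trans (submxMl _ _) (row_gram A).
have [Y YA YE] : exists2 Y, (Y <= A)%MS & Y *m A^T = (1%:M - Q) *m A^T.
  by exists (W *m A); rewrite ?submxMl // -mulmxA WE.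
have AY : A *m Y^T = A *m (1%:M - Q).
  by apply: trmx_inj; rewrite !trmx_mul trmxK YE hQ'.1.
have Yle : sigma_min A * fnorm Y <= fnorm (M - A).
  apply: le_trans (sigma_min_le_mx YA) _; rewrite YE.
  have -> : (1%:M - Q) *m A^T = (1%:M - Q) *m (A - M)^T.
    have QM0 : (1%:M - Q) *m M^T = 0.
      apply: trmx_inj; rewrite trmx_mul trmxK hQ'.1.
      by rewrite mulmxBr mulmx1 MQ subrr trmx0.
    by rewrite linearB /= mulmxBr QM0 subr0.
  by rewrite fnormBC -(fnorm_tr (A - M)) fnorm_projl.
have -> : (1%:M - P) *m A *m (1%:M - Q) = (1%:M - P) *m ((A - M) *m Y^T).
  have PM0 : (1%:M - P) *m M = 0 by rewrite mulmxBl mul1mx PM subrr.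
  by rewrite [RHS]mulmxA (mulmxBr _ A M) PM0 subr0 -[RHS]mulmxA AY mulmxA.
have h : fnorm ((1%:M - P) *m ((A - M) *m Y^T)) <= fnorm (M - A) * fnorm Y.
  apply: le_trans (fnorm_projl _ hP') _.
  by rewrite (fnormBC M) -(fnorm_tr Y) fnormM.
apply: le_trans (ler_wpM2l sig0 h) _.
by rewrite mulrCA expr2 ler_wpM2l ?fnorm_ge0.
Qed.

Lemma fnorm_le_fnorm_r m n r (G B : 'M[R]_(m, n)) : (\rank B <= r)%N ->
  fdot G B = fnorm B ^+ 2 -> fnorm B <= fnorm_r r G.
Proof.
move=> rB GB; have [->|B0] := eqVneq (fnorm B) 0; first exact: fnorm_ge0.
have B1 : 0 < fnorm B by rewrite lt_def B0 fnorm_ge0.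
by rewrite -(ler_pM2r B1) -expr2 -GB fdot_le_fnorm_r.
Qed.

Lemma fnorm_colproj m n r (U : 'M[R]_(m, r)) (G : 'M[R]_(m, n)) :
  U^T *m U = 1%:M -> fnorm (U *m U^T *m G) <= fnorm_r r G.
Proof.
move=> UU; have [PT PP] := orth_projU UU; apply: fnorm_le_fnorm_r.
  rewrite -mulmxA; apply: leq_trans (mxrankM_maxl _ _) (rank_leq_col _).
by rewrite fnorm_sqr fdot_mulmxl PT mulmxA PP.
Qed.

Lemma fnorm_rowproj m n r (V : 'M[R]_(n, r)) (G : 'M[R]_(m, n)) :
  V^T *m V = 1%:M -> fnorm (G *m (V *m V^T)) <= fnorm_r r G.
Proof.
move=> VV; have [QT QQ] := orth_projU VV; apply: fnorm_le_fnorm_r.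
  apply: leq_trans (mxrankM_maxr _ _) _.
  by apply: leq_trans (mxrankM_maxl _ _) (rank_leq_col _).
by rewrite fnorm_sqr fdot_mulmxr QT -mulmxA QQ.
Qed.

(** The two summands have orthogonal column spaces. *)
Lemma tangent_projE m n r (U : 'M[R]_(m, r)) (V : 'M[R]_(n, r)) G :
  tangent_proj U V G =
  U *m U^T *m G + (1%:M - U *m U^T) *m (G *m (V *m V^T)).
Proof. by rewrite mulmxBl mul1mx addrA /tangent_proj !mulmxA. Qed.

Lemma fnorm_tangent_proj m n r (U : 'M[R]_(m, r)) (V : 'M[R]_(n, r)) G :
  U^T *m U = 1%:M -> V^T *m V = 1%:M ->
  fnorm (tangent_proj U V G) ^+ 2 <= 2 * fnorm_r r G ^+ 2.
Proof.
move=> UU VV; rewrite tangent_projE (pythagoras _ _ (orth_projU UU)).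
rewrite mulr_natl mulr2n lerD // ler_sqr ?nnegrE ?fnorm_ge0 ?fnorm_colproj //.
apply: le_trans (fnorm_rowproj G VV).
exact/fnorm_projl/orth_projC/orth_projU.
Qed.

(** The tangent projection is self-adjoint, with complement
    X |-> (1 - U U^T) X (1 - V V^T). *)
Lemma fdot_tangent_proj m n r (U : 'M[R]_(m, r)) (V : 'M[R]_(n, r)) G X :
  fdot (tangent_proj U V G) X =
  fdot G X - fdot G ((1%:M - U *m U^T) *m X *m (1%:M - V *m V^T)).
Proof.
rewrite /tangent_proj -!(mulmxA _ V V^T).
have [PT QT] : (U *m U^T)^T = U *m U^T /\ (V *m V^T)^T = V *m V^T.
  by rewrite !trmx_mul !trmxK.
move: (U *m U^T) (V *m V^T) PT QT => P Q PT QT.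
rewrite fdotBl fdotDl !(fdot_mulmxr _ Q) !(fdot_mulmxl P) PT QT.
rewrite !(mulmxBl, mulmxBr, mul1mx, mulmx1, fdotBr) mulmxA; ring.
Qed.

Lemma fnorm_mul_diag m n (B : 'M[R]_(m, n)) (d : 'rV[R]_n) c :
  0 <= c -> (forall i, `|d 0 i| <= c) -> fnorm (B *m diag_mx d) <= c * fnorm B.
Proof.
move=> c0 dc; rewrite -[c in leRHS](ger0_norm c0) -fnormZ fnorm_le.
apply: ler_sum => i _; apply: ler_sum => j _.
rewrite mul_mx_diag !mxE -!expr2 !exprMn mulrC ler_wpM2r ?sqr_ge0 //.
by rewrite -(real_normK (num_real (d 0 j))) ler_sqr ?nnegrE.
Qed.

(** Let N = V S^-1 U^T be the pseudo-inverse of M = U S V^T, and split the step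
    into X1, with columns in the span of U, and X2, with rows in the span of V.
    The matrix (M + X2) N (M + X1) has rank at most r and differs from M + X1 + X2 by
    X2 N X1, which is quadratic in the step. *)
Lemma svd_retraction_second_order m n r (M M' G : 'M[R]_(m, n)) U s V eta delta :
  is_thin_svd M U s V -> 0 < delta -> (forall i : 'I_r, delta <= s 0 i) ->
  is_svd_trunc r (M - eta *: tangent_proj U V G) M' ->
  delta * fnorm (M' - (M - eta *: tangent_proj U V G)) <=
    eta ^+ 2 * fnorm_r r G ^+ 2.
Proof.
move=> [UU VV s0 _ ME] d0 ds [_ M'min].
set W := M - _ in M'min *.
pose t := map_mx (fun x => x^-1) s.
pose N := V *m diag_mx t *m U^T.
pose X1 := - eta *: (U *m U^T *m G).
pose X2 := - eta *: ((1%:M - U *m U^T) *m (G *m (V *m V^T))).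
have WE : W = M + X1 + X2.
  by rewrite /W tangent_projE -scaleNr scalerDr addrA.
have s_neq0 i : s 0 i != 0 by rewrite gt_eqF // (lt_le_trans d0).
have st : diag_mx s *m diag_mx t = 1%:M.
  apply/matrixP => i j; rewrite mul_diag_mx !mxE.
  by case: eqVneq => [->|]; rewrite ?mulr1n ?mulr0n ?mulr0 ?mulfV.
have ts : diag_mx t *m diag_mx s = 1%:M.
  apply/matrixP => i j; rewrite mul_diag_mx !mxE.
  by case: eqVneq => [->|]; rewrite ?mulr1n ?mulr0n ?mulr0 ?mulVf.
have MN : M *m N = U *m U^T.
  rewrite ME /N !mulmxA -(mulmxA (U *m diag_mx s)) VV mulmx1.
  by rewrite -(mulmxA U) st mulmx1.
have NM : N *m M = V *m V^T.
  rewrite ME /N !mulmxA -(mulmxA (V *m diag_mx t)) UU mulmx1.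
  by rewrite -(mulmxA V) ts mulmx1.
have PM : U *m U^T *m M = M by rewrite ME !mulmxA -(mulmxA U) UU mulmx1.
have X1E : U *m U^T *m X1 = X1.
  by rewrite /X1 -scalemxAr !mulmxA -(mulmxA U U^T U) UU mulmx1.
have X2E : X2 *m (V *m V^T) = X2.
  by rewrite /X2 -scalemxAl -!mulmxA (mulmxA V^T V) VV mul1mx.
pose C := (M + X2) *m N *m (M + X1).
have rC : low_rank r C.
  rewrite /low_rank /= /C /N; apply: leq_trans (mxrankM_maxl _ _) _.
  apply: leq_trans (mxrankM_maxr _ _) _; rewrite -mulmxA.
  by apply: leq_trans (mxrankM_maxl _ _) (rank_leq_col _).
have CE : C = W + X2 *m N *m X1.
  rewrite /C mulmxDl MN mulmxDl !mulmxDr PM X1E -(mulmxA X2 N M) NM X2E WE.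
  by rewrite !addrA.
have := M'min C rC; rewrite fnormBC => le1.
have le2 : fnorm (W - C) = fnorm (X2 *m N *m X1).
  by rewrite CE opprD addrA subrr add0r fnormN.
have le3 : delta * fnorm (X2 *m N *m X1) <= fnorm X2 * fnorm X1.
  rewrite /N !mulmxA -(mulmxA _ U^T).
  have di0 : 0 <= delta^-1 by rewrite invr_ge0 ltW.
  have tle i : `|t 0 i| <= delta^-1.
    rewrite mxE ger0_norm ?invr_ge0 // lef_pV2 ?posrE //.
    exact: lt_le_trans (ds i).
  have h1 : fnorm (X2 *m V *m diag_mx t) <= delta^-1 * fnorm X2.
    apply: le_trans (fnorm_mul_diag _ di0 tle) _.
    by rewrite ler_wpM2l // fnorm_orth_mulr.
  have h2 : fnorm (U^T *m X1) = fnorm X1.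
    by rewrite -(fnorm_orthl (U^T *m X1) UU) mulmxA X1E.
  have h3 : fnorm (X2 *m V *m diag_mx t *m (U^T *m X1)) <=
      delta^-1 * fnorm X2 * fnorm X1.
    by apply: le_trans (fnormM _ _) _; rewrite h2 ler_wpM2r ?fnorm_ge0.
  apply: le_trans (ler_wpM2l (ltW d0) h3) _.
  by rewrite !mulrA mulfV ?gt_eqF // mul1r.
apply: le_trans (ler_wpM2l (ltW d0) le1) _; rewrite le2.
apply: le_trans le3 _.
rewrite !fnormZ normrN mulrACA -expr2 (real_normK (num_real _)).
rewrite ler_wpM2l ?sqr_ge0 // expr2 ler_pM ?fnorm_ge0 ?fnorm_colproj //.
apply: le_trans (fnorm_rowproj G VV).
exact/fnorm_projl/orth_projC/orth_projU.
Qed.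

End Geometry.

(** * One iteration *)

Section Iteration.
Context {R : realType}.
Implicit Types m n r : nat.

(** G is paired with M - A, whose rank may be 2r.  Projecting on the column
    space of M and on its complement splits M - A into two orthogonal pieces of
    rank at most r, which costs a factor sqrt 2. *)
Lemma sharpness_le_subgradient m n r (A M M' : 'M[R]_(m, n)) f eta L g :
  \rank A = r -> rsgrad_step r f eta M M' ->
  (forall G, subdifferential f M G -> fnorm_r r G <= L) ->
  0 <= g -> g <= f M - f A -> g ^+ 2 <= 2 * L ^+ 2 * fnorm (M - A) ^+ 2.
Proof.
move=> rA [G [U [s [V [fG [UU VV s0 sdec ME] _]]]]] GL g0 gf.
have FL := GL G fG; have F0 : 0 <= fnorm_r r G by exact: fnorm_ge0.
have L0 := le_trans F0 FL.
have gG : g <= fdot G (M - A).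
  have := fG A; rewrite -opprB fdotNr; lra.
have PM : U *m U^T *m M = M by rewrite ME !mulmxA -(mulmxA U) UU mulmx1.
have hP := orth_projU UU.
have rP X : (\rank (U *m U^T *m X : 'M[R]_(m, n)) <= r)%N.
  rewrite -mulmxA; apply: leq_trans (mxrankM_maxl _ _) (rank_leq_col _).
have rPC : (\rank ((1%:M - U *m U^T) *m (M - A)) <= r)%N.
  rewrite mulmxBr [(1%:M - _) *m M]mulmxBl mul1mx PM subrr sub0r.
  by rewrite mxrank_opp (leq_trans (mxrankM_maxr _ _)) ?rA.
move: (M - A) gG rPC => X gG rPC.
have := fdot_le_fnorm_r G (rP X); have := fdot_le_fnorm_r G rPC.
move: (U *m U^T) hP {rP rPC PM} => P hP.
have XE : X = P *m X + (1%:M - P) *m X by rewrite -mulmxDl subrKC mul1mx.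
have := pythagoras X X hP; rewrite -XE.
have := fnorm_ge0 (P *m X); have := fnorm_ge0 ((1%:M - P) *m X).
move: gG; rewrite {1}XE fdotDr.
set x := fnorm (P *m X); set y := fnorm (_ *m X) => gG y0 x0 D2 hy hx.
have gL : g <= L * (x + y).
  have := ler_wpM2r x0 FL; have := ler_wpM2r y0 FL; lra.
have : g ^+ 2 <= (L * (x + y)) ^+ 2.
  by rewrite ler_sqr ?nnegrE // mulr_ge0 // addr_ge0.
move=> /le_trans; apply; rewrite exprMn (mulrC 2) -[leRHS]mulrA.
rewrite ler_wpM2l ?sqr_ge0 // D2; have := sqr_ge0 (x - y); lra.
Qed.

(** Here a is the distance to A before the truncation and e the error made by the
    truncation.  The condition 2 D <= sigma makes the singular values of M at
    least sigma / 2. *)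
Lemma rsgrad_step_bound m n r (A M M' : 'M[R]_(m, n)) f eta L g :
  \rank A = r -> rsgrad_step r f eta M M' ->
  0 < fnorm (M - A) -> 2 * fnorm (M - A) <= sigma_min A ->
  (forall G, subdifferential f M G -> fnorm_r r G <= L) ->
  g <= f M - f A -> 0 <= eta ->
  let D := fnorm (M - A) in
  exists a e, [/\ 0 <= a, fnorm (M' - A) <= a + e,
        a ^+ 2 <= D ^+ 2 - 2 * eta * (g - L * D ^+ 2 / sigma_min A)
              + 2 * eta ^+ 2 * L ^+ 2
    & e <= 2 * eta ^+ 2 * L ^+ 2 / sigma_min A].
Proof.
move=> rA [G [U [s [V [fG svdM truncM']]]]] D0 Dsig GL gf eta0 D.
have [UU VV s0 sdec ME] := svdM.
have sig0 : 0 < sigma_min A by lra.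
have L0 : 0 <= L by apply: le_trans (GL G fG); exact: fnorm_ge0.
have FL := GL G fG; have F0 : 0 <= fnorm_r r G by exact: fnorm_ge0.
have F2L2 : fnorm_r r G ^+ 2 <= L ^+ 2 by rewrite ler_sqr ?nnegrE.
set X := M - A.
have gG : g <= fdot G X.
  have := fG A; rewrite -opprB fdotNr -/X; lra.
have PM : U *m U^T *m M = M by rewrite ME !mulmxA -(mulmxA U) UU mulmx1.
have MQ : M *m (V *m V^T) = M by rewrite ME !mulmxA -(mulmxA _ V^T) VV mulmx1.
have hP := orth_projU UU; have hQ := orth_projU VV.
set P := U *m U^T in PM hP; set Q := V *m V^T in MQ hQ.
have PCX : (1%:M - P) *m X = - ((1%:M - P) *m A).
  by rewrite /X mulmxBr [(1%:M - P) *m M]mulmxBl mul1mx PM subrr sub0r.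
have rPC : (\rank ((1%:M - P) *m X) <= r)%N.
  by rewrite PCX mxrank_opp -rA mxrankM_maxr.
pose T := tangent_proj U V G.
exists (fnorm (M - eta *: T - A)), (fnorm (M' - (M - eta *: T))).
have sD i : sigma_min A / 2 <= s 0 i.
  have := thin_svd_gap i rA svdM; lra.
have sig2 : 0 < sigma_min A / 2 by rewrite divr_gt0.
split; first exact: fnorm_ge0.
- by rewrite [leRHS]addrC; exact: fnorm_triangle.
- have -> : M - eta *: T - A = X - eta *: T by rewrite /X addrAC.
  have TX : g - L * D ^+ 2 / sigma_min A <= fdot T X.
    rewrite /T fdot_tangent_proj -/P -/Q.
    have := curvature_bound hP hQ PM MQ (ltW sig0).
    rewrite mulrC -ler_pdivlMr // -/D => cv.
    have rB : (\rank ((1%:M - P) *m X *m (1%:M - Q)) <= r)%N.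
      exact: leq_trans (mxrankM_maxl _ _) rPC.
    have := fdot_le_fnorm_r G rB.
    have -> : fnorm ((1%:M - P) *m X *m (1%:M - Q)) =
              fnorm ((1%:M - P) *m A *m (1%:M - Q)).
      by rewrite PCX mulNmx fnormN.
    have := ler_pM F0 (fnorm_ge0 _) FL cv; rewrite mulrA; lra.
  have TT : fnorm T ^+ 2 <= 2 * L ^+ 2.
    by apply: le_trans (fnorm_tangent_proj G UU VV) _; rewrite ler_pM2l.
  rewrite fnormB_sqr fdotZr (fdotC X T) fnormZ exprMn (real_normK (num_real _)) -/D.
  have := ler_wpM2l eta0 TX; have := ler_wpM2l (sqr_ge0 eta) TT; lra.
- rewrite ler_pdivlMr // mulrC.
  have := svd_retraction_second_order svdM sig2 sD truncM'; rewrite -/T.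
  have := ler_wpM2l (sqr_ge0 eta) F2L2; lra.
Qed.

Lemma sharpness_ratio_le2 m n r (A M M' : 'M[R]_(m, n)) f eta mu L :
  \rank A = r -> rsgrad_step r f eta M M' ->
  0 < mu -> 0 < L -> 0 < fnorm (M - A) ->
  (forall G, subdifferential f M G -> fnorm_r r G <= L) ->
  mu * fnorm (M - A) <= f M - f A -> mu ^+ 2 / L ^+ 2 <= 2.
Proof.
move=> rA step mu0 L0 D0 GL gf; rewrite ler_pdivrMr ?exprn_gt0 //.
have := sharpness_le_subgradient rA step GL (ltW (mulr_gt0 mu0 D0)) gf.
by rewrite exprMn ler_pM2r ?exprn_gt0.
Qed.

(** The stepsize is measured by x relative to E mu / L^2, where E bounds D; E is
    not D itself because the decaying schedule follows the guaranteed bound on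
    the distance and not the distance.  The last hypothesis states that, without
    curvature, the squared distance would contract by 1 - t / 5.  The curvature
    costs 9/400 t in the square, and 9/400 t again in the truncation. *)
Lemma rsgrad_step_contraction m n r (A M M' : 'M[R]_(m, n)) f mu L x E :
  let D := fnorm (M - A) in let t := mu ^+ 2 / L ^+ 2 in
  \rank A = r -> rsgrad_step r f (x * E * (mu / L ^+ 2)) M M' ->
  0 < mu -> 0 < L -> 0 < D -> D <= E -> 100 * E <= sigma_min A * t ->
  (forall G, subdifferential f M G -> fnorm_r r G <= L) ->
  mu * D <= f M - f A -> t <= 2 -> 0 <= x -> x <= 3 / 4 ->
  D ^+ 2 - 2 * x * t * D * E + 2 * x ^+ 2 * t * E ^+ 2 <= (1 - t / 5) * E ^+ 2 ->
  fnorm (M' - A) <= (1 - t / 25) * E.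
Proof.
move=> D t rA step mu0 L0 D0 DE Esig GL gf t2 x0 x34 H.
have E0 : 0 < E by lra.
have t0 : 0 < t by rewrite divr_gt0 // exprn_gt0.
have sig0 : 0 < sigma_min A by rewrite -(pmulr_lgt0 _ t0); lra.
have Dsig : 2 * fnorm (M - A) <= sigma_min A by rewrite -/D; nra.
have eta0 : 0 <= x * E * (mu / L ^+ 2).
  exact: mulr_ge0 (mulr_ge0 x0 (ltW E0)) (divr_ge0 (ltW mu0) (sqr_ge0 L)).
have [a [e [a0 M'A]]] := rsgrad_step_bound rA step D0 Dsig GL gf eta0.
clear rA step; rewrite -/D.
pose k := mu / L; pose w := E / sigma_min A.
have tk : t = k ^+ 2 by rewrite /k expr_div_n.
have k0 : 0 < k by rewrite divr_gt0.
have k32 : k <= 3 / 2.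
  have : k ^+ 2 <= (3 / 2) ^+ 2 by rewrite -tk; lra.
  by rewrite ler_sqr // nnegrE ?(ltW k0) // divr_ge0.
have w0 : 0 < w by rewrite divr_gt0.
have w100 : 100 * w <= t by rewrite mulrA ler_pdivrMr // [t * _]mulrC.
have -> : D ^+ 2 - 2 * (x * E * (mu / L ^+ 2)) * (mu * D - L * D ^+ 2 / sigma_min A)
    + 2 * (x * E * (mu / L ^+ 2)) ^+ 2 * L ^+ 2 =
    D ^+ 2 - 2 * x * t * D * E + 2 * x ^+ 2 * t * E ^+ 2
    + 2 * x * k * w * D ^+ 2.
  by rewrite /t /k /w; field; rewrite ?(gt_eqF L0) ?(gt_eqF sig0).
have -> : 2 * (x * E * (mu / L ^+ 2)) ^+ 2 * L ^+ 2 / sigma_min A =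
    2 * x ^+ 2 * t * w * E.
  by rewrite /t /w; field; rewrite ?(gt_eqF L0) ?(gt_eqF sig0).
move=> aub eub.
have xk : 2 * x * k <= 9 / 4 by nra.
have curv : 2 * x * k * w * D ^+ 2 <= 9 / 400 * t * E ^+ 2.
  have cw : 2 * x * k * w <= 9 / 400 * t.
    by have := ler_wpM2r (ltW w0) xk; lra.
  apply: le_trans (ler_wpM2r (sqr_ge0 D) cw) _.
  by rewrite ler_wpM2l ?ler_sqr ?nnegrE ?(ltW D0) ?(ltW E0) //
     mulr_ge0 ?(ltW t0) ?divr_ge0.
have x2 : x ^+ 2 <= 9 / 16 by nra.
have x2t : 2 * x ^+ 2 * t <= 9 / 4 by have := sqr_ge0 x; nra.
have retr : e <= 9 / 400 * t * E.
  apply: le_trans eub _; rewrite ler_wpM2r ?(ltW E0) //.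
  have := ler_wpM2r (ltW w0) x2t; lra.
have asq : a ^+ 2 <= ((1 - t / 25 - 9 / 400 * t) * E) ^+ 2.
  have t1 : 1 - t / 5 + 9 / 400 * t <= (1 - t / 25 - 9 / 400 * t) ^+ 2.
    have := sqr_ge0 (t / 25 + 9 / 400 * t); nra.
  rewrite exprMn; apply: le_trans (ler_wpM2r (sqr_ge0 E) t1).
  lra.
have : a <= (1 - t / 25 - 9 / 400 * t) * E.
  move: asq; rewrite ler_sqr // nnegrE mulr_ge0 ?(ltW E0) //; lra.
lra.
Qed.

End Iteration.

(** * Stepsizes and convergence *)

Section Stepsizes.
Context {R : realType}.

(** The left-hand side is convex in D, so only the endpoints D = 0 and D = E
    matter; their role is played by the two signs of 1 - 2 x t. *)
Lemma quadratic_decrease_decaying (t x D E : R) :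
  0 <= t -> t <= 2 -> 2 / 10 <= x -> x <= 3 / 10 -> 0 <= D -> D <= E ->
  D ^+ 2 - 2 * x * t * D * E + 2 * x ^+ 2 * t * E ^+ 2 <= (1 - t / 5) * E ^+ 2.
Proof.
move=> t0 t2 x2 x3 D0 DE.
have E0 : 0 <= E by lra.
have DDE : D ^+ 2 <= D * E by rewrite expr2 ler_wpM2l.
have [xt|xt] := leP (1 - 2 * x * t) 0.
  have h1 : (1 - 2 * x * t) * (D * E) <= 0 by rewrite mulr_le0_ge0 // mulr_ge0.
  have xx : 2 * x ^+ 2 <= 18 / 100 by nra.
  have h2 : 2 * x ^+ 2 * t <= 1 - t / 5 by have := ler_wpM2r t0 xx; lra.
  have := ler_wpM2r (sqr_ge0 E) h2; lra.
have h1 : (1 - 2 * x * t) * (D * E) <= (1 - 2 * x * t) * E ^+ 2.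
  by rewrite ler_wpM2l ?(ltW xt) // expr2 ler_wpM2r.
have xx : 2 / 10 <= 2 * x - 2 * x ^+ 2 by nra.
have h2 : (1 - 2 * x * t) + 2 * x ^+ 2 * t <= 1 - t / 5.
  by have := ler_wpM2r t0 xx; lra.
have := ler_wpM2r (sqr_ge0 E) h2; lra.
Qed.

Lemma quadratic_decrease_constant (t x D : R) :
  0 <= t -> 125 / 1000 <= x -> x <= 75 / 100 ->
  D ^+ 2 - 2 * x * t * D * D + 2 * x ^+ 2 * t * D ^+ 2 <= (1 - t / 5) * D ^+ 2.
Proof.
move=> t0 x1 x2; have xx : 2 / 10 <= 2 * x - 2 * x ^+ 2 by nra.
have h2 : (1 - 2 * x * t) + 2 * x ^+ 2 * t <= 1 - t / 5.
  by have := ler_wpM2r t0 xx; lra.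
have := ler_wpM2r (sqr_ge0 D) h2; lra.
Qed.

End Stepsizes.

Unset Implicit Arguments.

Theorem proposition1 (R : realType) :
  exists c0 : R, 0 < c0 /\
  forall (d1 d2 r : nat) (Mstar : 'M[R]_(d1, d2)) (f : 'M[R]_(d1, d2) -> R)
    (tauc taus muc mus Lc Ls : R)
    (c eta0 eta2 : R) (eta : nat -> R) (M : nat -> 'M[R]_(d1, d2)),
  (0 < r)%N -> \rank Mstar = r ->
  (forall A, 0 <= f A) ->
  0 < taus -> taus < tauc ->
  0 < muc -> 0 < mus -> 0 < Lc -> 0 < Ls ->
  two_phase_regular r f Mstar tauc taus muc mus Lc Ls ->
  rsgrad r f eta M ->
  fnorm (M 0%N - Mstar) <=
    c0 * sigma_min Mstar * Num.min (mus ^+ 2 / Ls ^+ 2) (muc ^+ 2 / Lc ^+ 2) ->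
  2 / 10 * fnorm (M 0%N - Mstar) * (muc / Lc ^+ 2) <= eta0 ->
  eta0 <= 3 / 10 * fnorm (M 0%N - Mstar) * (muc / Lc ^+ 2) ->
  0 < c -> c <= 4 / 100 ->
  mus / Ls ^+ 2 * (125 / 1000) <= eta2 ->
  eta2 <= mus / Ls ^+ 2 * (75 / 100) ->
  (* stepsize schedule *)
  (forall l, tauc <= fnorm (M l - Mstar) ->
     eta l = (1 - c * (muc ^+ 2 / Lc ^+ 2)) ^+ l * eta0) ->
  (forall l, taus <= fnorm (M l - Mstar) < tauc -> eta l = eta2) ->
  (* l ranges over the iterations of the two phases: once an iterate is within
     taus of Mstar the stepsizes are no longer prescribed *)
  forall l, (forall k, (k < l)%N -> taus <= fnorm (M k - Mstar)) ->
    (tauc <= fnorm (M l - Mstar) ->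
       fnorm (M l.+1 - Mstar) <=
         (1 - c * (muc ^+ 2 / Lc ^+ 2)) ^+ l.+1 * fnorm (M 0%N - Mstar)) /\
    (taus <= fnorm (M l - Mstar) < tauc ->
       fnorm (M l.+1 - Mstar) <=
         (1 - mus ^+ 2 / (32 * Ls ^+ 2)) * fnorm (M l - Mstar)).
Proof.
(* The contraction lemma asks for E <= sigma_min A * t / 100. *)
exists (1 / 100); split; first by lra.
move=> d1 d2 r A f tauc taus muc mus Lc Ls c eta0 eta2 eta M _ rA _.
move=> taus0 tausc muc0 mus0 Lc0 Ls0 [sharp1 sharp2 grad1 grad2] [low0 step].
move=> init eta0l eta0u c0 c4 eta2l eta2u etaE1 etaE2.
set q := 1 - c * (muc ^+ 2 / Lc ^+ 2).
set tc := muc ^+ 2 / Lc ^+ 2 in q *.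
pose ts := mus ^+ 2 / Ls ^+ 2.
pose D l := fnorm (M l - A).
have Dge0 l : 0 <= D l by exact: fnorm_ge0.
have tc0 : 0 < tc by rewrite divr_gt0 // exprn_gt0.
have ts0 : 0 < ts by rewrite divr_gt0 // exprn_gt0.
have lowM l : low_rank r (M l).
  by case: l => // l; have [G [U [s [V [_ _ []]]]]] := step l.
have sig0 : 0 < D 0%N -> 0 < sigma_min A.
  move=> D0; have min0 : 0 < Num.min ts tc by rewrite lt_min ts0.
  rewrite -(pmulr_lgt0 _ min0) -(pmulr_rgt0 _ (_ : 0 < 1 / 100)) ?divr_gt0 //.
  by rewrite mulrA; apply: lt_le_trans init.
have initct : 0 < D 0%N ->
    100 * D 0%N <= sigma_min A * tc /\ 100 * D 0%N <= sigma_min A * ts.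
  move=> /sig0 s0; have sm t : Num.min ts tc <= t ->
      100 * D 0%N <= sigma_min A * t.
    move=> /(ler_wpM2l (ltW s0)); move: init; rewrite -/(D 0%N) -/ts.
    by clear -R; lra.
  by split; apply: sm; rewrite ge_min lexx ?orbT.
have DM l : 0 < D l -> D l <= D 0%N -> 0 < D 0%N by exact: lt_le_trans.
(* The decaying stepsize is the one of the contraction lemma when E is the
   guaranteed bound q^l D 0. *)
have phase1 l : D l <= D 0%N -> tauc <= D l -> D l <= q ^+ l * D 0%N ->
    [/\ 0 <= q, q <= 1 & D l.+1 <= q ^+ l.+1 * D 0%N].
  move=> Dl0 tauD DE; have B1 : phase_one_set r A tauc (M l) by split.
  have Dl : 0 < D l by apply: lt_le_trans tauD; exact: lt_trans tausc.
  have D00 := DM l Dl Dl0; have [initc _] := initct D00.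
  have GL G := grad1 (M l) G B1; have gf := sharp1 (M l) B1.
  have t2 : tc <= 2 := sharpness_ratio_le2 rA (step l) muc0 Lc0 Dl GL gf.
  have ct2 : c * tc <= 8 / 100.
    by apply: le_trans (ler_pM (ltW c0) (ltW tc0) c4 t2) _; clear; lra.
  have ct0 : 0 < c * tc by exact: mulr_gt0.
  have q0 : 0 < q by rewrite /q; clear -ct2; lra.
  have q1 : q <= 1 by rewrite /q; clear -ct0; lra.
  split=> //; first exact: ltW.
  have ql0 : 0 < q ^+ l by rewrite exprn_gt0.
  have ql1 : q ^+ l <= 1 by rewrite exprn_ile1 ?(ltW q0).
  have ml0 : 0 < muc / Lc ^+ 2 by rewrite divr_gt0 // exprn_gt0.
  have dm0 : 0 < D 0%N * (muc / Lc ^+ 2) by exact: mulr_gt0.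
  pose x := eta0 / (D 0%N * (muc / Lc ^+ 2)).
  have x2 : 2 / 10 <= x by rewrite /x ler_pdivlMr // [leLHS]mulrA.
  have x3 : x <= 3 / 10 by rewrite /x ler_pdivrMr // [leRHS]mulrA.
  have etal : eta l = x * (q ^+ l * D 0%N) * (muc / Lc ^+ 2).
    rewrite (etaE1 l tauD) -/tc -/q /x; field.
    by rewrite (gt_eqF Lc0) (gt_eqF D00) (gt_eqF muc0).
  have stepl := step l; rewrite etal in stepl.
  have E0 : q ^+ l * D 0%N <= D 0%N by rewrite ler_piMl ?(ltW D00).
  have Esig : 100 * (q ^+ l * D 0%N) <= sigma_min A * tc.
    by clear -E0 initc; lra.
  have x0 : 0 <= x by clear -x2; lra.
  have x34 : x <= 3 / 4 by clear -x3; lra.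
  have H := quadratic_decrease_decaying (ltW tc0) t2 x2 x3 (ltW Dl) DE.
  have := rsgrad_step_contraction rA stepl muc0 Lc0 Dl DE Esig GL gf t2 x0 x34 H.
  move=> /le_trans; apply; rewrite [q ^+ l.+1]exprS -[leRHS]mulrA.
  rewrite ler_wpM2r ?mulr_ge0 ?(ltW ql0) ?(ltW D00) // /q.
  by move: (ler_wpM2r (ltW tc0) c4); rewrite -/tc; clear; lra.
have phase2 l : D l <= D 0%N -> taus <= D l < tauc ->
    D l.+1 <= (1 - mus ^+ 2 / (32 * Ls ^+ 2)) * D l.
  move=> Dl0 /[dup] tauD /andP[tauD1 tauD2].
  have B2 : phase_two_set r A tauc taus (M l) by split.
  have Dl : 0 < D l by exact: lt_le_trans tauD1.
  have D00 := DM l Dl Dl0; have [_ inits] := initct D00.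
  have GL G := grad2 (M l) G B2; have := sharp2 (M l) B2.
  rewrite expr2 mulrA => gf.
  have mD := mulr_gt0 mus0 Dl; have LD := mulr_gt0 Ls0 Dl.
  (* The contraction lemma is used with mus * D l, Ls * D l and D l in the roles
     of mu, L and E. *)
  have tE : (mus * D l) ^+ 2 / (Ls * D l) ^+ 2 = ts.
    by rewrite /ts; field; rewrite (gt_eqF Ls0) (gt_eqF Dl).
  have t2 : ts <= 2.
    by rewrite -tE; exact: sharpness_ratio_le2 rA (step l) mD LD Dl GL gf.
  have ml0 : 0 < mus / Ls ^+ 2 by rewrite divr_gt0 // exprn_gt0.
  pose x := eta2 / (mus / Ls ^+ 2).
  have x1 : 125 / 1000 <= x by rewrite /x ler_pdivlMr // [leLHS]mulrC.
  have x2 : x <= 75 / 100 by rewrite /x ler_pdivrMr // [leRHS]mulrC.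
  have x0 : 0 <= x by clear -x1; lra.
  have x34 : x <= 3 / 4 by clear -x2; lra.
  have etal : eta l = x * D l * (mus * D l / (Ls * D l) ^+ 2).
    rewrite (etaE2 l tauD) /x; field.
    by rewrite (gt_eqF Ls0) (gt_eqF Dl) (gt_eqF mus0).
  have stepl := step l; rewrite etal in stepl.
  have Esig : 100 * D l <= sigma_min A * ((mus * D l) ^+ 2 / (Ls * D l) ^+ 2).
    by rewrite tE; clear -Dl0 inits; lra.
  have H := quadratic_decrease_constant (D l) (ltW ts0) x1 x2.
  rewrite -tE in t2 H.
  have := rsgrad_step_contraction rA stepl mD LD Dl (lexx _) Esig GL gf t2 x0 x34 H.
  move=> /le_trans; apply; rewrite tE ler_wpM2r ?(ltW Dl) // lerB //.
  have -> : mus ^+ 2 / (32 * Ls ^+ 2) = ts / 32.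
    by rewrite /ts; field; rewrite (gt_eqF Ls0).
  by clear -ts0; lra.
have inv l : (forall k, (k < l)%N -> taus <= D k) ->
    D l <= D 0%N /\ (tauc <= D l -> D l <= q ^+ l * D 0%N).
  elim: l => [_|l IH far]; first by rewrite expr0 mul1r.
  have [Dl0 Dlq] := IH (fun k kl => far k (ltnW kl)).
  have tauD := far l (ltnSn l).
  have [tcD|Dtc] := leP tauc (D l).
    have [q0 q1 Dq] := phase1 l Dl0 tcD (Dlq tcD).
    split=> //; apply: le_trans Dq _.
    exact: ler_piMl (Dge0 _) (exprn_ile1 _ q0 q1).
  have Dl1 := phase2 l Dl0 (introT andP (conj tauD Dtc)).
  (* An iterate of phase two stays below tauc, so its successor is not in phase
     one. *)
  have le1 : D l.+1 <= D l.
    apply: le_trans Dl1 (ler_piMl (Dge0 _) _); rewrite gerBl.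
    by rewrite divr_ge0 ?mulr_ge0 ?exprn_ge0 ?(ltW mus0) ?(ltW Ls0).
  split; first exact: le_trans Dl0.
  by move=> tcD; have := lt_le_trans Dtc tcD; rewrite ltNge le1.
move=> l far; have [Dl0 Dlq] := inv l far; split=> [tcD|]; last exact: phase2.
by have [] := phase1 l Dl0 tcD (Dlq tcD).
Qed.
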